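(* Consider the marker-and-cell (staggered grid) discretization of the steady Stokes problem on a rectangle with $n_x\times n_y$ square cells of side $h$, with viscosity $\mu=1$, so that $A=-L$, where $L$ is the discrete vector Laplacian, $G$ is the discrete gradient and $G^*=-D$ is its transpose (all defined in the context). (i) For purely Dirichlet boundary conditions, let $\beta>0$ be a constant, independent of the mesh refinement, for which the discrete inf-sup condition $$\sup_{0\ne\mathbf u\in\mathbf U}\frac{(G^*\mathbf u,p)_0}{\|\mathbf u\|_1}\ \ge\ \beta\,\|p\|_0\qquad\text{for all } p\in\mathbf P$$ holds. Then every eigenvalue of the Schur complement $G^*A^{-1}G$, acting on $\mathbb R^{n_xn_y}$, lies in $\{0\}\cup[\beta^2,1]$, and the eigenvalue $0$ has multiplicity $1$. (ii) For purely Dirichlet boundary conditions with $n_x=n_y=n$, at most $4(n-1)$ eigenvalues of $G^*A^{-1}G$ (counted with multiplicity) are not equal to $1$; if $n_x\ne n_y$, at most $2(n_x-1)+2(n_y-1)$ eigenvalues (counted with multiplicity) are not equal to $1$. For boundary conditions that are periodic in the $x$-direction and Dirichlet in the $y$-direction, at most $2n_x$ eigenvalues of $G^*A^{-1}G$ (counted with multiplicity) are not equal to $1$.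
   Context: Let $n_x,n_y\ge 2$ be integers and $h>0$. For $m\ge2$, let $B_D^{(m)}$ be the $m\times(m-1)$ matrix with entries $-1$ on the main diagonal, $1$ on the first subdiagonal and $0$ elsewhere. Put $T_D^{(m)}=(B_D^{(m)})^TB_D^{(m)}$ (size $(m-1)\times(m-1)$, tridiagonal with $2$ on the diagonal and $-1$ off the diagonal), $T_N^{(m)}=B_D^{(m)}(B_D^{(m)})^T$, and $T_E^{(m)}=T_N^{(m)}+2E_0^{(m)}$, where $E_0^{(m)}=\mathrm{diag}(1,0,\dots,0,1)$ of size $m\times m$ (so $T_E^{(m)}$ is tridiagonal with diagonal $(3,2,\dots,2,3)$ and off-diagonal entries $-1$). Let $B_P^{(m)}$ be the $m\times m$ circulant matrix $I-C$, where $C_{i,i+1}=1$ with indices mod $m$, and $T_P^{(m)}=B_P^{(m)}(B_P^{(m)})^T$ (the periodic second-difference matrix). Pressure unknowns (cell centers) form $\mathbb R^{n_xn_y}$, ordered lexicographically ($x$ index fastest); velocity unknowns $\mathbf u=(u,v)$ are the values on the vertical and horizontal cell faces which carry unknowns. Purely Dirichlet case: the velocity space is $\mathbf U=\mathbb R^{(n_x-1)n_y}\times\mathbb R^{n_x(n_y-1)}$ and $$-L=\frac1{h^2}\begin{bmatrix} I_{n_y}\otimes T_D^{(n_x)}+T_E^{(n_y)}\otimes I_{n_x-1}&0\\0&I_{n_y-1}\otimes T_E^{(n_x)}+T_D^{(n_y)}\otimes I_{n_x}\end{bmatrix},\quad G^*=\frac1h\begin{bmatrix}I_{n_y}\otimes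 B_D^{(n_x)}& B_D^{(n_y)}\otimes I_{n_x}\end{bmatrix}.$$ Case periodic in $x$, Dirichlet in $y$: the velocity space is $\mathbf U=\mathbb R^{n_xn_y}\times\mathbb R^{n_x(n_y-1)}$ and $$-L=\frac1{h^2}\begin{bmatrix} I_{n_y}\otimes T_P^{(n_x)}+T_E^{(n_y)}\otimes I_{n_x}&0\\0&I_{n_y-1}\otimes T_P^{(n_x)}+T_D^{(n_y)}\otimes I_{n_x}\end{bmatrix},\quad G^*=\frac1h\begin{bmatrix}I_{n_y}\otimes B_P^{(n_x)}& B_D^{(n_y)}\otimes I_{n_x}\end{bmatrix}.$$ In both cases $G=(G^* )^T$ is the discrete gradient, $D=-G^*$ is the discrete divergence, and $-L$ is symmetric positive definite. $\mathbf P\subset\mathbb R^{n_xn_y}$ is the subspace of pressures with mean value $0$. Norms: $(p,q)_0=h^2\,p^Tq$, $\|p\|_0^2=(p,p)_0$, $(\mathbf u,\mathbf v)_{\mathbf U}=h^2\,\mathbf u^T\mathbf v$, and $\|\mathbf u\|_1^2=(-L\mathbf u,\mathbf u)_{\mathbf U}$. It is known that for a fixed rectangle an inf-sup constant $\beta>0$ independent of $h$ exists in the purely Dirichlet case (it depends on the aspect ratio of the rectangle). *)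

(* Defs.v *)
From HB Require Import structures.
From mathcomp Require Import all_boot all_order all_algebra.
From mathcomp Require Import mxtens.
From mathcomp Require Import all_classical all_reals ereal.

Set Implicit Arguments.
Unset Strict Implicit.
Unset Printing Implicit Defensive.

Import Order.TTheory GRing.Theory Num.Theory.

Local Open Scope classical_set_scope.
Local Open Scope ring_scope.

(* The Kronecker product is [A *t B] (mxtens): the index of the second factor
   varies fastest, so with the y-factor on the left the unknowns are ordered
   lexicographically with the x index running fastest. *)

Section Matrices.
Variable R : realType.

Definition B_D (m : nat) : 'M[R]_(m, m.-1) :=
  \matrix_(i, j) (if i == j :> nat then -1 else if i == j.+1 :> nat then 1 else 0).

Definition T_D (m : nat) : 'M[R]_(m.-1) := (B_D m)^T *m B_D m.

Definition T_N (m : nat) : 'M[R]_m := B_D m *m (B_D m)^T.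

Definition E_0 (m : nat) : 'M[R]_m :=
  \matrix_(i, j) (if (i == j) && ((i == 0%N :> nat) || (i == m.-1 :> nat))
                  then 1 else 0).

Definition T_E (m : nat) : 'M[R]_m := T_N m + 2%:R *: E_0 m.

Definition B_P (m : nat) : 'M[R]_m :=
  1%:M - \matrix_(i, j) (if j == (i.+1 %% m)%N :> nat then 1 else 0).

Definition T_P (m : nat) : 'M[R]_m := B_P m *m (B_P m)^T.

Definition negL_dir (nx ny : nat) (h : R) :
    'M[R]_(ny * nx.-1 + ny.-1 * nx) :=
  (h ^+ 2)^-1 *:
    block_mx (1%:M *t T_D nx + T_E ny *t 1%:M) 0
             0 (1%:M *t T_E nx + T_D ny *t 1%:M).

Definition Gstar_dir (nx ny : nat) (h : R) :
    'M[R]_(ny * nx, ny * nx.-1 + ny.-1 * nx) :=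
  h^-1 *: row_mx (1%:M *t B_D nx) (B_D ny *t 1%:M).

Definition negL_per (nx ny : nat) (h : R) :
    'M[R]_(ny * nx + ny.-1 * nx) :=
  (h ^+ 2)^-1 *:
    block_mx (1%:M *t T_P nx + T_E ny *t 1%:M) 0
             0 (1%:M *t T_P nx + T_D ny *t 1%:M).

Definition Gstar_per (nx ny : nat) (h : R) :
    'M[R]_(ny * nx, ny * nx + ny.-1 * nx) :=
  h^-1 *: row_mx (1%:M *t B_P nx) (B_D ny *t 1%:M).

End Matrices.

Section Operators.
Variable R : realType.

(* The h^2-weighted inner product, used for both pressures and velocities. *)
Definition ip (h : R) (N : nat) (x y : 'cV[R]_N) : R :=
  h ^+ 2 * (x^T *m y) 0 0.

Definition norm0 (h : R) (N : nat) (p : 'cV[R]_N) : R := Num.sqrt (ip h p p).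

Definition norm1 (h : R) (M : nat) (A : 'M[R]_M) (u : 'cV[R]_M) : R :=
  Num.sqrt (ip h (A *m u) u).

Definition mean (N : nat) (p : 'cV[R]_N) : R := (\sum_i p i 0) / N%:R.

(* The supremum is taken in the extended reals because the real [sup] has a
   junk value on unbounded sets. *)
Definition inf_sup (h : R) (N M : nat) (A : 'M[R]_M) (Gs : 'M[R]_(N, M))
    (beta : R) : Prop :=
  forall p : 'cV[R]_N, mean p = 0 ->
    ((beta * norm0 h p)%:E <=
     ereal_sup [set (ip h (Gs *m u) p / norm1 h A u)%:E
                | u in [set u : 'cV[R]_M | u != 0%R]])%E.

Definition schur (N M : nat) (A : 'M[R]_M) (Gs : 'M[R]_(N, M)) : 'M[R]_N :=
  Gs *m invmx A *m Gs^T.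

(* [s] lists all the eigenvalues of [S], each repeated according to its
   (algebraic) multiplicity; it is unique up to permutation. *)
Definition spectrum (N : nat) (S : 'M[R]_N) (s : seq R) : Prop :=
  char_poly S = \prod_(a <- s) ('X - a%:P).

Definition at_most_not_one (N : nat) (S : 'M[R]_N) (k : nat) : Prop :=
  exists s : seq R, spectrum S s /\ (count (fun a => a != 1%R) s <= k)%N.

End Operators.

(* Main.v *)
Require Import Defs.
From HB Require Import structures.
From mathcomp Require Import all_boot all_order all_algebra.
From mathcomp Require Import fingroup perm.
From mathcomp Require Import all_classical all_reals ereal.
From mathcomp Require Import mxtens complex ring zify.

Set Implicit Arguments.
Unset Strict Implicit.
Unset Printing Implicit Defensive.

Import Order.TTheory GRing.Theory Num.Theory.

Local Open Scope ring_scope.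

(* For an eigenpair (lambda, p) of G^* A^{-1} G put u = A^{-1} G p; then
   u^T A u = lambda |p|^2 and |G^* u|^2 = lambda^2 |p|^2. A discrete curl shows
   that A - G G^* is positive semidefinite, hence lambda <= 1; the inf-sup
   condition says that p^T G^* A^{-1} G p >= beta^2 |p|^2 on mean-zero p.

   For the multiplicity of 1: if q vanishes on the cells adjacent to a Dirichlet
   wall, the boundary corrections 2 E_0 do not act on G q, so
   A G q = G (G^* G) q, and p = G^* G q satisfies G^* A^{-1} G p = p. As G is
   injective on such q, the eigenspace of 1 has codimension at most the number
   of cells adjacent to a Dirichlet wall. *)

(** * Spectrum of a real symmetric matrix *)

Lemma rank_diag_mx (F : fieldType) n (d : 'rV[F]_n) :
  \rank (diag_mx d) = (\sum_i (d ord0 i != 0%R))%N.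
Proof.
elim: n d => [|n IHn] d; first by rewrite flatmx0 mxrank0 big_ord0.
pose l := lsubmx (d : 'rV_(1 + n)); pose r := rsubmx (d : 'rV_(1 + n)).
transitivity (\rank (block_mx (diag_mx l) 0 0 (diag_mx r))).
  by rewrite -diag_mx_row hsubmxK.
rewrite rank_diag_block_mx IHn (@big_split_ord _ _ _ 1 n) big_ord1.
congr (_ + _)%N; last by apply: eq_bigr => i _; rewrite mxE.
have -> : d ord0 (@lshift 1 n ord0) = l 0 0 by rewrite mxE.
rewrite [diag_mx _]mx11_scalar mxE eqxx mulr1n -scalemx1.
by case: eqP => [->|/eqP nz]; rewrite ?scale0r ?mxrank0 ?mxrank_scale_nz ?mxrank1.
Qed.

Lemma char_poly_conj (F : fieldType) n (P A : 'M[F]_n) :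
  P \in unitmx -> char_poly (invmx P *m A *m P) = char_poly A.
Proof.
move=> uP; rewrite /char_poly /char_poly_mx.
have uP' : map_mx polyC P \in unitmx.
  by rewrite unitmxE det_map_mx rmorph_unit // -unitmxE.
have -> : 'X%:M - map_mx polyC (invmx P *m A *m P) =
   map_mx polyC (invmx P) *m ('X%:M - map_mx polyC A) *m map_mx polyC P.
  rewrite mulmxBr mulmxBl !map_mxM /=; congr (_ - _).
  by rewrite scalar_mxC -mulmxA -map_mxM mulVmx // map_mx1 mulmx1.
by rewrite !det_mulmx mulrAC -det_mulmx -map_mxM mulVmx // map_mx1 det1 mul1r.
Qed.

(** Over the complex numbers [S] is Hermitian, hence unitarily diagonalizable with real diagonal
    [e]. Shifting by [a] shifts the diagonal, so the rank counts the entries different from [a].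
    This turns every multiplicity below into a rank. *)
Lemma symmetric_spectrum (R : realType) n (S : 'M[R]_n) : S^T = S ->
  exists s : seq R, spectrum S s /\
    forall a, count (fun x => x != a) s = \rank (S - a%:M).
Proof.
move=> Ssym; pose f := real_complex R; pose SC := map_mx f S.
have SCherm : SC \is hermsymmx.
  apply: realsym_hermsym.
    by apply/is_hermitianmxP; rewrite expr0 scale1r map_mx_id // /SC map_trmx Ssym.
  by apply/mxOverP => i j; rewrite mxE complex_real.
have /orthomx_spectralP SCE := hermitian_normalmx SCherm.
have dreal := hermitian_spectral_diag_real SCherm.
set P := spectralmx SC in SCE; set d := spectral_diag SC in SCE dreal.
have uP : P \in unitmx by apply: spectral_unit.
pose e i : R := complex.Re (d 0 i).
have eE i : f (e i) = d 0 i by apply: RRe_real; apply/mxOverP.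
exists [seq e i | i <- enum 'I_n]; split.
  apply: (map_poly_inj f); rewrite map_char_poly -/SC SCE char_poly_conj //.
  rewrite char_poly_trig ?diag_mx_is_trig // rmorph_prod big_map big_enum /=.
  apply: eq_bigr => i _.
  by rewrite mxE eqxx mulr1n rmorphB /= map_polyX map_polyC -eE.
move=> a; rewrite -(mxrank_map f) map_mxB map_scalar_mx -/SC.
have -> : SC - (f a)%:M = invmx P *m diag_mx (d - const_mx (f a)) *m P.
  rewrite raddfB /= diag_const_mx mulmxBr mulmxBl -SCE.
  by rewrite scalar_mxC mulmxKV.
rewrite mxrankMfree ?row_free_unit // eqmxMfull ?row_full_unit ?unitmx_inv //.
rewrite rank_diag_mx count_map -sum1_count big_enum_cond /= big_mkcond /=.
apply: eq_bigr => i _; rewrite !mxE subr_eq0 -eE (inj_eq (@complexI R)).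
by case: eqP.
Qed.

(** * Positive semidefinite and Gram matrices *)

Definition psd (R : realType) n (M : 'M[R]_n) : Prop :=
  forall u : 'cV[R]_n, 0 <= (u^T *m M *m u) 0 0.

Section Psd.
Variable R : realType.

Lemma sqnorm_ge0 n (x : 'cV[R]_n) : 0 <= (x^T *m x) 0 0.
Proof. by rewrite mxE sumr_ge0 // => i _; rewrite mxE sqr_ge0. Qed.

Lemma sqnorm_eq0 n (x : 'cV[R]_n) : (x^T *m x) 0 0 = 0 -> x = 0.
Proof.
rewrite mxE => /psumr_eq0P x0; apply/colP => i; rewrite [RHS]mxE; apply/eqP.
rewrite -sqrf_eq0 expr2; apply/eqP.
by have := x0 _ i isT; rewrite mxE; apply => j _; rewrite mxE sqr_ge0.
Qed.

Lemma psd_gram m n (X : 'M[R]_(m, n)) : psd (X^T *m X).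
Proof. by move=> u; rewrite mulmxA -trmx_mul -mulmxA sqnorm_ge0. Qed.

Lemma psdD n (M N : 'M[R]_n) : psd M -> psd N -> psd (M + N).
Proof. by move=> pM pN u; rewrite mulmxDr mulmxDl mxE addr_ge0. Qed.

Lemma psdZ n c (M : 'M[R]_n) : 0 <= c -> psd M -> psd (c *: M).
Proof. by move=> c0 pM u; rewrite -scalemxAr -scalemxAl mxE mulr_ge0. Qed.

(** At a kernel vector both nonnegative quadratic forms must vanish; the first gives [X v = 0], and
    the left inverse [Y] then gives [v = 0]. *)
Lemma gram_psd_unit m n (X : 'M[R]_(m, n)) Y Z :
  Y *m X = 1%:M -> psd Z -> X^T *m X + Z \in unitmx.
Proof.
move=> YX pZ; rewrite -unitmx_tr -row_free_unit; apply: inj_row_free => v.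
move=> /(congr1 trmx); rewrite trmx_mul trmxK trmx0 => v0.
have : (v^T^T *m (X^T *m X + Z) *m v^T) 0 0 = 0.
  by rewrite -mulmxA v0 mulmx0 mxE.
rewrite mulmxDr mulmxDl mxE => /eqP; rewrite paddr_eq0 ?psd_gram ?pZ //.
case/andP=> /eqP + _; rewrite mulmxA -trmx_mul -mulmxA => /sqnorm_eq0 Xv.
by rewrite -[v]trmxK -[v^T]mul1mx -YX -mulmxA Xv mulmx0 trmx0.
Qed.

Lemma psd_cauchy_schwarz n (A : 'M[R]_n) (u w : 'cV[R]_n) :
  A^T = A -> psd A -> 0 < (u^T *m A *m u) 0 0 ->
  (u^T *m A *m w) 0 0 ^+ 2 <= (u^T *m A *m u) 0 0 * (w^T *m A *m w) 0 0.
Proof.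
move=> Asym pA; set c := (u^T *m A *m u) 0 0; set b := (u^T *m A *m w) 0 0.
set a := (w^T *m A *m w) 0 0 => c0.
have bE : (w^T *m A *m u) 0 0 = b.
  by rewrite /b -[A in RHS]Asym -[w in RHS]trmxK -!trmx_mul mulmxA [RHS]mxE.
(* Positivity at b u - c w avoids dividing by w^T A w, which may vanish. *)
have := pA (b *: u - c *: w).
have -> : ((b *: u - c *: w)^T *m A *m (b *: u - c *: w)) 0 0 = c * (c * a - b ^+ 2).
  have -> : (b *: u - c *: w)^T = b *: u^T - c *: w^T by rewrite linearB !linearZ.
  rewrite !(mulmxBl, mulmxBr) -!(scalemxAl, scalemxAr).
  set m1 := u^T *m A *m u; set m2 := u^T *m A *m w.
  set m3 := w^T *m A *m u; set m4 := w^T *m A *m w.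
  have [e1 e2 e3 e4] : [/\ m1 0 0 = c, m2 0 0 = b, m3 0 0 = b & m4 0 0 = a] by [].
  move: m1 m2 m3 m4 e1 e2 e3 e4 => m1 m2 m3 m4 e1 e2 e3 e4.
  by rewrite !mxE e1 e2 e3 e4; ring.
by rewrite pmulr_rge0 // subr_ge0 mulrC.
Qed.
End Psd.

(** * Spectral bounds for an abstract Schur complement *)

Section Schur.
Variables (R : realType) (N M : nat) (A : 'M[R]_M) (Gs : 'M[R]_(N, M)).
Hypotheses (A_unit : A \in unitmx) (A_sym : A^T = A).
Local Notation S := (schur A Gs).

Lemma schur_sym : S^T = S.
Proof. by rewrite /schur !trmx_mul trmxK trmx_inv A_sym mulmxA. Qed.

Lemma schur_form (p : 'cV[R]_N) (u := invmx A *m (Gs^T *m p)) :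
  u^T *m A *m u = p^T *m S *m p.
Proof.
rewrite /u -[_ *m A *m _]mulmxA mulKVmx // !trmx_mul trmxK trmx_inv A_sym.
by rewrite /schur !mulmxA.
Qed.

Lemma eigenvalue_schur lambda : eigenvalue S lambda ->
  exists2 p : 'cV[R]_N, S *m p = lambda *: p & 0 < (p^T *m p) 0 0.
Proof.
case/eigenvalueP => v Sv nzv; exists v^T.
  by rewrite -schur_sym -trmx_mul Sv linearZ.
rewrite lt_def sqnorm_ge0 andbT; apply: contra_neq nzv => /sqnorm_eq0.
by move/(congr1 trmx); rewrite trmxK trmx0.
Qed.

Lemma schur_form_eigen lambda (p : 'cV[R]_N) : S *m p = lambda *: p ->
  (p^T *m S *m p) 0 0 = lambda * (p^T *m p) 0 0.
Proof. by move=> Sp; rewrite -mulmxA Sp -scalemxAr mxE. Qed.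

Lemma schur_eigenvalue_le1 lambda :
  psd (A - Gs^T *m Gs) -> eigenvalue S lambda -> lambda <= 1.
Proof.
move=> div_le /eigenvalue_schur[p Sp p_gt0].
pose u := invmx A *m (Gs^T *m p).
have Gu : Gs *m u = lambda *: p by rewrite -Sp /schur /u !mulmxA.
(* Positivity at [u] reads [(lambda - lambda^2) |p|^2 >= 0], so [lambda^2 <= lambda], which excludes
   [lambda > 1]. *)
have := div_le u; rewrite mulmxBr mulmxBl schur_form; clearbody u.
have -> : u^T *m (Gs^T *m Gs) *m u = lambda ^+ 2 *: (p^T *m p).
  rewrite mulmxA -trmx_mul -mulmxA Gu [(_ *: _)^T]linearZ -scalemxAl -scalemxAr scalerA.
  by rewrite -expr2.
move: (schur_form_eigen Sp) p_gt0.
move: (p^T *m S *m p) (p^T *m p) => a q aE q_gt0.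
rewrite !mxE aE -mulrBl pmulr_lge0 //.
rewrite expr2 subr_ge0 => ll.
case: (leP lambda 1) => // l1.
by move: ll; rewrite leNgt ltr_pMl ?l1 // (lt_trans ltr01).
Qed.

(** With [w = A^-1 G p], the pairing of [G^* u] with [p] is the [A]-inner product of [u] and [w].
    Cauchy-Schwarz bounds every quotient in the supremum by the [A]-norm of [w], whose square is the
    Schur form at [p] up to the weight [h^2]. *)
Lemma inf_sup_schur h beta (p : 'cV[R]_N) :
  psd A -> 0 < h -> 0 <= beta -> inf_sup h A Gs beta -> mean p = 0 ->
  beta ^+ 2 * (p^T *m p) 0 0 <= (p^T *m S *m p) 0 0.
Proof.
move=> pA h0 b0 is_h p0; set q := (p^T *m S *m p) 0 0.
have h20 : 0 < h ^+ 2 by rewrite exprn_gt0.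
have q0 : 0 <= q by rewrite /q -schur_form pA.
have : beta * norm0 h p <= Num.sqrt (h ^+ 2 * q).
  rewrite -lee_fin; apply: (le_trans (is_h _ p0)).
  apply: ge_ereal_sup => _ [u _ <-]; rewrite lee_fin.
  rewrite /Defs.norm1 /ip !trmx_mul A_sym; set c := (u^T *m A *m u) 0 0.
  (* If [c = 0], the quotient is a division by zero, which has value 0 and satisfies the bound. *)
  have [c_gt0|c_le0] := ltP 0 c; last first.
    have -> : c = 0 by apply/eqP; rewrite eq_le c_le0 pA.
    by rewrite mulr0 sqrtr0 invr0 mulr0 sqrtr_ge0.
  rewrite ler_pdivrMr ?sqrtr_gt0 ?mulr_gt0 // -sqrtrM ?mulr_ge0 ?(ltW h0) //.
  apply: le_trans (ler_norm _) _; rewrite -sqrtr_sqr ler_wsqrtr //.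
  have := @psd_cauchy_schwarz _ _ _ u (invmx A *m (Gs^T *m p)) A_sym pA c_gt0.
  rewrite schur_form -/c -/q -[in X in X -> _]mulmxA mulKVmx // mulmxA -trmx_mul => CS.
  rewrite exprMn expr2 -mulrA [leRHS](_ : _ = h ^+ 2 * (h ^+ 2 * (c * q))); last by ring.
  by rewrite !ler_wpM2l ?(ltW h20).
rewrite /norm0 /ip => le_b.
have := lerXn2r 2 _ _ le_b; rewrite !nnegrE mulr_ge0 ?sqrtr_ge0 // => /(_ isT isT).
have hp := mulr_ge0 (ltW h20) (sqnorm_ge0 p); have hq := mulr_ge0 (ltW h20) q0.
by rewrite exprMn !sqr_sqrtr // mulrCA ler_pM2l.
Qed.

Lemma schur_spectrum_inf_sup h beta :
  (0 < N)%N -> psd (A - Gs^T *m Gs) -> Gs^T *m const_mx 1 = 0 :> 'cV_M ->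
  0 < h -> 0 < beta -> inf_sup h A Gs beta ->
  exists s : seq R,
     [/\ spectrum S s,
         forall lambda : R, eigenvalue S lambda ->
           lambda = 0 \/ beta ^+ 2 <= lambda <= 1
       & count_mem 0 s = 1%N].
Proof.
move=> N0 div_le G1 h0 b0 is_h.
have pA : psd A by rewrite -[A](subrK (Gs^T *m Gs)); apply: psdD => //; apply: psd_gram.
pose o : 'cV[R]_N := const_mx 1.
have S1 : S *m o = 0 by rewrite /schur -mulmxA G1 mulmx0.
have oS : o^T *m S = 0 by rewrite -schur_sym -trmx_mul S1 trmx0.
have sumE (p : 'cV[R]_N) : \sum_i p i 0 = (o^T *m p) 0 0.
  by rewrite mxE; apply: eq_bigr => i _; rewrite !mxE mul1r.
have NR : N%:R != 0 :> R by rewrite pnatr_eq0 -lt0n.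
have bound := inf_sup_schur pA h0 (ltW b0) is_h.
have [s [sS cs]] := symmetric_spectrum schur_sym.
exists s; split => // [lambda ev|].
  have [->|nz] := eqVneq lambda 0; [by left|right].
  rewrite schur_eigenvalue_le1 // andbT.
  have [p Sp p_gt0] := eigenvalue_schur ev.
  (* Constants are annihilated by [S] from the left, so [lambda] times the sum of the entries of [p]
     is 0; as [lambda] is nonzero, the inf-sup bound applies to [p]. *)
  have p0 : mean p = 0.
    have : lambda * \sum_i p i 0 = 0.
      have -> : lambda * \sum_i p i 0 = (o^T *m (lambda *: p)) 0 0.
        by rewrite sumE -scalemxAr [RHS]mxE.
      by rewrite -Sp mulmxA oS mul0mx mxE.
    by move/eqP; rewrite mulf_eq0 (negPf nz) /mean => /eqP ->; rewrite mul0r.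
  by have := bound p p0; rewrite (schur_form_eigen Sp) ler_pM2r.
(* The kernel is the line of constants: subtracting its mean from a kernel vector leaves a mean-zero
   kernel vector, which the inf-sup bound forces to be 0. *)
have rk : \rank (kermx S) = 1%N.
  have <- : \rank o^T = 1%N.
    rewrite rank_rV; case: eqP => // /rowP /(_ (Ordinal N0)) /eqP.
    by rewrite !mxE oner_eq0.
  apply/eqP; rewrite eqn_leq !mxrankS //; first by apply/sub_kermxP.
  apply/rV_subP => v /sub_kermxP vS; apply/sub_rVP; exists (mean v^T).
  pose p := v^T - mean v^T *: o.
  have Sp : S *m p = 0.
    by rewrite mulmxBr -scalemxAr S1 scaler0 subr0 -schur_sym -trmx_mul vS trmx0.
  have p0 : mean p = 0.
    have pE i : p i 0 = v^T i 0 - mean v^T by rewrite !mxE mulr1.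
    rewrite /mean (eq_bigr _ (fun i _ => pE i)) sumrB sumr_const card_ord.
    by rewrite -[_ *+ N]mulr_natr /mean divfK // subrr mul0r.
  have := bound p p0; rewrite -mulmxA Sp mulmx0 [X in _ <= X]mxE.
  rewrite pmulr_rle0 ?exprn_gt0 // => p_le0.
  have /sqnorm_eq0 /eqP : (p^T *m p) 0 0 = 0.
    by apply/eqP; rewrite eq_le p_le0 sqnorm_ge0.
  by rewrite subr_eq0 => /eqP /(congr1 trmx); rewrite trmxK linearZ.
(* Of the [N] entries of [s], exactly [\rank S] are nonzero; the remaining ones number the dimension
   of the kernel, which is 1. *)
have size_s : size s = N.
  by apply: succn_inj; rewrite -(size_prod_XsubC _ id) -sS size_char_poly.
have := count_predC (pred1 0) s; rewrite size_s.
have -> : count (predC (pred1 0)) s = \rank S.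
  by rewrite -[S in RHS]subr0 -(raddf0 (@scalar_mx R N)) -cs.
by move: rk (rank_leq_row S); rewrite mxrank_ker; lia.
Qed.
End Schur.

(** The columns of [P] span the admissible [q]. The commutation hypothesis makes [S] fix the columns
    of [G^* G P], and these are independent, so [S - 1] has rank at most [N - d]. *)
Lemma at_most_not_one_schur (R : realType) N M d (A : 'M[R]_M)
    (Gs : 'M[R]_(N, M)) (P : 'M[R]_(N, d)) Y k :
  A \in unitmx -> A^T = A ->
  A *m Gs^T *m P = Gs^T *m Gs *m Gs^T *m P ->
  Y *m (Gs^T *m P) = 1%:M -> (N <= d + k)%N ->
  at_most_not_one (schur A Gs) k.
Proof.
move=> A_unit A_sym AGP YGP Nk.
have [s [sS cs]] := symmetric_spectrum (schur_sym Gs A_sym).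
exists s; split=> //; rewrite cs; set S := schur A Gs.
set X := Gs^T *m P in YGP.
have SX : (S - 1%:M) *m (Gs *m X) = 0.
  rewrite mulmxBl mul1mx /S /schur /X !mulmxA.
  have -> : Gs *m invmx A *m Gs^T *m Gs *m Gs^T *m P = Gs *m Gs^T *m P.
    have -> : Gs *m invmx A *m Gs^T *m Gs *m Gs^T *m P =
      Gs *m (invmx A *m (Gs^T *m Gs *m Gs^T *m P)) by rewrite !mulmxA.
    by rewrite -AGP -mulmxA mulKmx // mulmxA.
  by rewrite subrr.
(* Multiplying by [P^T] on the left gives the Gram matrix [X^T X], which is invertible since [X] has
   a left inverse. *)
have rX : (d <= \rank (Gs *m X))%N.
  rewrite (leq_trans _ (mxrankM_maxr P^T _)) // mulmxA.
  have -> : P^T *m Gs = X^T by rewrite trmx_mul trmxK.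
  have : X^T *m X \in unitmx.
    rewrite -[X in X \in _]addr0; apply: gram_psd_unit YGP _ => u.
    by rewrite mulmx0 mul0mx mxE.
  by rewrite -row_free_unit => /eqP ->.
rewrite -(leq_add2l d) (leq_trans _ Nk) // addnC.
by rewrite (leq_trans _ (mulmx0_rank_max SX)) // leq_add2l.
Qed.

(** * Algebra of Kronecker products *)

Section Kronecker.
Variable R : comPzRingType.

Lemma tensmxDl m n p q (A B : 'M[R]_(m, n)) (C : 'M[R]_(p, q)) :
  (A + B) *t C = A *t C + B *t C.
Proof. by apply/matrixP => i j; rewrite !mxE mulrDl. Qed.

Lemma tensmxDr m n p q (A B : 'M[R]_(m, n)) (C : 'M[R]_(p, q)) :
  C *t (A + B) = C *t A + C *t B.
Proof. by apply/matrixP => i j; rewrite !mxE mulrDr. Qed.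

Lemma tensmxZl m n p q c (A : 'M[R]_(m, n)) (C : 'M[R]_(p, q)) :
  (c *: A) *t C = c *: (A *t C).
Proof. by apply/matrixP => i j; rewrite !mxE mulrA. Qed.

Lemma tensmxZr m n p q c (A : 'M[R]_(m, n)) (C : 'M[R]_(p, q)) :
  C *t (c *: A) = c *: (C *t A).
Proof. by apply/matrixP => i j; rewrite !mxE mulrCA. Qed.

Lemma tensmx11 m n : (1%:M : 'M[R]_m) *t (1%:M : 'M[R]_n) = 1%:M.
Proof.
apply/matrixP => i j.
case: (mxtens_indexP i) => i0 i1.
case: (mxtens_indexP j) => j0 j1.
have E := can_eq (@mxtens_indexK m n) (i0, i1) (j0, j1).
by rewrite tensmxE !mxE E xpair_eqE -natrM mulnb.
Qed.
End Kronecker.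

(** Injectivity is recorded by left inverses because these multiply under Kronecker products. *)
Lemma left_inverse_mx (F : fieldType) m n (X : 'M[F]_(m, n)) :
  (forall q : 'cV_n, X *m q = 0 -> q = 0) -> exists Y, Y *m X = 1%:M.
Proof.
move=> Xinj; have : row_free X^T.
  apply: inj_row_free => v vX; apply: trmx_inj; rewrite trmx0; apply: Xinj.
  by rewrite -[X]trmxK -trmx_mul vX trmx0.
case/row_freeP => Y XY; exists Y^T.
by rewrite -[X]trmxK -trmx_mul XY trmx1.
Qed.

(** * One-dimensional difference matrices *)

Section OneDimensional.
Variable R : realType.

(* Extension by zero of a vector indexed by the cells 1, ..., m - 2. *)
Definition interior_mx m : 'M[R]_(m, m.-2) :=
  \matrix_(i, j) (if i == j.+1 :> nat then 1 else 0).

Lemma trmx_E_0 m : (E_0 R m)^T = E_0 R m.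
Proof.
by apply/matrixP => i j; rewrite !mxE eq_sym; case: eqP => //= ->.
Qed.

Lemma trmx_T_D m : (T_D R m)^T = T_D R m.
Proof. by rewrite trmx_mul trmxK. Qed.

Lemma trmx_T_E m : (T_E R m)^T = T_E R m.
Proof. by rewrite linearD linearZ /= trmx_E_0 trmx_mul trmxK. Qed.

Lemma trmx_T_P m : (T_P R m)^T = T_P R m.
Proof. by rewrite trmx_mul trmxK. Qed.

Lemma E_0_idem m : E_0 R m *m E_0 R m = E_0 R m.
Proof.
apply/matrixP => i j; rewrite !mxE (bigD1 j) //= big1 ?addr0; last first.
  by move=> k /negPf kj; rewrite !mxE kj mulr0.
by rewrite !mxE eqxx /=; case: eqP => [->|]; case: ifP; rewrite ?mulr1 ?mulr0 ?mul0r.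
Qed.

Lemma E_0_interior m : E_0 R m *m interior_mx m = 0.
Proof.
apply/matrixP => i j; rewrite !mxE big1 // => k _; rewrite !mxE.
case: (k =P j.+1 :> nat) => [kj|]; last by rewrite mulr0.
case: (i =P k) => [->|]; last by rewrite mul0r.
rewrite kj /=; case: eqP => [jm|]; last by rewrite mul0r.
by have := ltn_ord j; move: jm; lia.
Qed.

Lemma interior_gram m : (interior_mx m)^T *m interior_mx m = 1%:M.
Proof.
apply/matrixP => i j; rewrite !mxE.
have im : (i.+1 < m)%N by have := ltn_ord i; lia.
rewrite (bigD1 (Ordinal im)) //= big1 ?addr0; last first.
  move=> k /eqP ki; rewrite !mxE; case: eqP => [e|]; last by rewrite mul0r.
  by case: ki; apply: val_inj.
rewrite !mxE eqxx mul1r eqSS; case: (i =P j) => [->|/eqP]; rewrite ?eqxx //=.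
by rewrite -val_eqE => /negPf ->.
Qed.

Lemma B_D_const m : (B_D R m)^T *m const_mx 1 = 0 :> 'cV_m.-1.
Proof.
apply/matrixP => i j; rewrite !mxE.
have im : (i < m)%N by have := ltn_ord i; lia.
have im1 : (i.+1 < m)%N by have := ltn_ord i; lia.
rewrite (bigD1 (Ordinal im)) //= (bigD1 (Ordinal im1)) /=; last first.
  by rewrite -val_eqE /= neq_ltn ltnSn orbT.
rewrite big1 => [|k /andP[ki ki1]].
  rewrite !mxE /= !eqxx !mulr1.
  by rewrite -[i.+1 == i]negbK neq_ltn ltnSn orbT addr0 addNr.
rewrite !mxE; move: ki ki1; rewrite -!val_eqE /= => /negPf -> /negPf ->.
by rewrite mul0r.
Qed.

Lemma B_D_left_inverse m : exists Y, Y *m B_D R m = 1%:M.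
Proof.
apply: left_inverse_mx => q Bq.
suff H n (j : 'I_m.-1) : j = n :> nat -> q j 0 = 0.
  (* Row [j] of [B_D q = 0] reads [q_(j-1) = q_j], and row 0 reads [q_0 = 0], so zeros propagate
     upwards. *)
  by apply/colP => j; rewrite mxE; apply: (H j).
elim/ltn_ind: n j => n IHn j jn.
have jm : (j < m)%N by have := ltn_ord j; lia.
have := congr1 (fun M : 'cV_m => M (Ordinal jm) 0) Bq.
rewrite !mxE (bigD1 j) //= big1 ?addr0 => [|k /eqP kj].
  by rewrite mxE eqxx mulN1r => /eqP; rewrite oppr_eq0 => /eqP.
rewrite mxE /=; case: (j =P k :> nat) => [/val_inj jk|_]; first by case: kj.
case: (j =P k.+1 :> nat) => [jk|_]; last by rewrite mul0r.
by rewrite (IHn k) ?mulr0 // -jn jk.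
Qed.

(** [B_D^T q = 0] makes [q] constant, and [E_0 q = 0] makes its first entry 0. This yields both the
    definiteness of [T_E] and the injectivity of the gradient on interior vectors. *)
Lemma B_D_E_0_left_inverse m :
  exists Y, Y *m col_mx (B_D R m)^T (E_0 R m) = 1%:M.
Proof.
apply: left_inverse_mx => q; rewrite mul_col_mx => /eqP.
rewrite col_mx_eq0 => /andP[/eqP Bq /eqP Eq].
suff H n (j : 'I_m) : j = n :> nat -> q j 0 = 0.
  by apply/colP => j; rewrite mxE; apply: (H j).
elim: n j => [|n IHn] j jn.
  have := congr1 (fun M : 'cV_m => M j 0) Eq; rewrite !mxE (bigD1 j) //= big1 ?addr0.
    by rewrite !mxE eqxx jn eqxx mul1r.
  by move=> k; rewrite mxE eq_sym => /negPf ->; rewrite mul0r.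
have nm : (n < m.-1)%N by have := ltn_ord j; lia.
have := congr1 (fun M : 'cV_m.-1 => M (Ordinal nm) 0) Bq.
rewrite !mxE (bigD1 j) //= big1 ?addr0 => [|k /eqP kj].
  by rewrite !mxE /= jn eqxx -[n.+1 == n]negbK neq_ltn ltnSn orbT mul1r.
rewrite !mxE /=; case: (k =P n :> nat) => [kn|_].
  by rewrite (IHn k) ?mulr0.
case: (k =P n.+1 :> nat) => [kn|_]; last by rewrite mul0r.
by case: kj; apply: val_inj; rewrite /= jn.
Qed.

(** On interior vectors the [E_0] block of the previous stacked matrix vanishes, so the left half of
    its left inverse already recovers them from their gradient. *)
Lemma gradient_interior_left_inverse m :
  exists Z, Z *m ((B_D R m)^T *m interior_mx m) = 1%:M.
Proof.
have [Y] := B_D_E_0_left_inverse m; rewrite -[Y]hsubmxK mul_row_col => YBE.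
exists ((interior_mx m)^T *m lsubmx Y); rewrite -mulmxA.
have -> : lsubmx Y *m ((B_D R m)^T *m interior_mx m) = interior_mx m.
  by rewrite -[RHS]mul1mx -YBE mulmxDl -!mulmxA E_0_interior mulmx0 addr0.
exact: interior_gram.
Qed.

Lemma T_E_gram m : exists k (K : 'M[R]_(k, m)),
  K^T *m K = T_E R m /\ exists Y, Y *m K = 1%:M.
Proof.
have [Y YK] := B_D_E_0_left_inverse m.
(* As [E_0] is a symmetric idempotent, stacking it twice produces the term [2 E_0] without a square
   root of 2. *)
exists ((m.-1 + m) + m)%N, (col_mx (col_mx (B_D R m)^T (E_0 R m)) (E_0 R m)); split.
  rewrite !tr_col_mx !mul_row_col trmxK trmx_E_0 E_0_idem -addrA.
  by rewrite /T_E -mulr2n scaler_nat.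
by exists (row_mx Y 0); rewrite mul_row_col mul0mx addr0.
Qed.

Lemma T_E_interior m : T_E R m *m interior_mx m = T_N R m *m interior_mx m.
Proof. by rewrite mulmxDl -scalemxAl E_0_interior scaler0 addr0. Qed.

(** [B_P] is the identity minus the permutation matrix of the cyclic shift, which commutes with its
    inverse, its transpose. Hence [T_P] can serve both as [B B^T] and as [B^T B]. *)
Lemma B_P_normal m : B_P R m *m (B_P R m)^T = (B_P R m)^T *m B_P R m.
Proof.
pose s := perm (@ordS_inj m).
have -> : B_P R m = 1%:M - perm_mx s.
  congr (_ - _); apply/matrixP => i j; rewrite !mxE permE -val_eqE /= eq_sym.
  by case: eqP.
rewrite linearB /= trmx1 tr_perm_mx !mulmxBl !mulmxBr !mul1mx !mulmx1.
by rewrite -!perm_mxM mulgV mulVg; apply/matrixP => i j; rewrite !mxE; ring.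
Qed.

End OneDimensional.

(** * Two-dimensional operators built from one-dimensional factors *)

Section TwoDimensional.
Variable R : realType.

(** Both summands are Gram matrices, of [1 *t Z] and of [X *t 1]; injectivity of either factor makes
    the sum definite. *)
Lemma kron_sum_unit k l m n (X : 'M[R]_(k, m)) (Z : 'M[R]_(l, n)) :
  (exists Y, Y *m X = 1%:M) \/ (exists Y, Y *m Z = 1%:M) ->
  1%:M *t (Z^T *m Z) + (X^T *m X) *t 1%:M \in unitmx.
Proof.
have -> : 1%:M *t (Z^T *m Z) = (1%:M *t Z : 'M[R]_(m * _, _))^T *m (1%:M *t Z).
  by rewrite trmx_tens tensmx_mul trmx1 mulmx1.
have -> : (X^T *m X) *t 1%:M = (X *t 1%:M : 'M[R]_(_, _ * n))^T *m (X *t 1%:M).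
  by rewrite trmx_tens tensmx_mul trmx1 mulmx1.
case=> -[Y YX]; [rewrite addrC|].
  apply: (@gram_psd_unit _ _ _ _ (Y *t 1%:M)); last exact: psd_gram.
  by rewrite tensmx_mul YX mulmx1 tensmx11.
apply: (@gram_psd_unit _ _ _ _ (1%:M *t Y)); last exact: psd_gram.
by rewrite tensmx_mul YX mulmx1 tensmx11.
Qed.

(** Factors acting in different directions commute, so the claim splits into one-dimensional
    identities. [D] acts along the difference direction of each velocity component, [L] across it;
    only [L] meets the wall corrections and needs [J]. The abstract form covers both kinds of
    boundary conditions. *)
Lemma gradient_laplacian_commute mx kx my ky dx dy
    (Bx : 'M[R]_(mx, kx)) (By : 'M[R]_(my, ky)) Dx Dy Lx Ly
    (Jx : 'M[R]_(mx, dx)) (Jy : 'M[R]_(my, dy)) :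
  Dx *m Bx^T = Bx^T *m Bx *m Bx^T -> Dy *m By^T = By^T *m By *m By^T ->
  Lx *m Jx = Bx *m Bx^T *m Jx -> Ly *m Jy = By *m By^T *m Jy ->
  let Gs := row_mx (1%:M *t Bx) (By *t 1%:M) in
  block_mx (1%:M *t Dx + Ly *t 1%:M) 0 0 (1%:M *t Lx + Dy *t 1%:M)
    *m Gs^T *m (Jy *t Jx) = Gs^T *m Gs *m Gs^T *m (Jy *t Jx).
Proof.
move=> Dxc Dyc LJx LJy /=.
rewrite tr_row_mx !trmx_tens !trmx1.
rewrite -[in RHS](mulmxA _ (row_mx _ _)) mul_block_col mul_row_col !mul_col_mx.
rewrite !mul0mx add0r addr0 !(mulmxDl, mulmxDr) !mulmxA !tensmx_mul.
by rewrite !(mul1mx, mulmx1) Dxc Dyc LJx LJy.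
Qed.

Lemma schur_scale N M (A : 'M[R]_M) (Gs : 'M[R]_(N, M)) c :
  c != 0 -> A \in unitmx ->
  schur ((c ^+ 2)^-1 *: A) (c^-1 *: Gs) = schur A Gs.
Proof.
move=> c0 uA; rewrite /schur invmxZ; last first.
  by rewrite unitmxZ // unitfE invr_eq0 expf_neq0.
rewrite invrK [(_ *: Gs)^T]linearZ /= -!(scalemxAl, scalemxAr) !scalerA.
have -> : c^-1 / c * c ^+ 2 = 1 by field.
by rewrite scale1r.
Qed.

Section Operators.
Variables (nx ny : nat).

Local Notation A_dir := (block_mx (1%:M *t T_D R nx + T_E R ny *t 1%:M) 0
             0 (1%:M *t T_E R nx + T_D R ny *t 1%:M)).
Local Notation G_dir := (row_mx (1%:M *t B_D R nx) (B_D R ny *t 1%:M)).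
Local Notation A_per := (block_mx (1%:M *t T_P R nx + T_E R ny *t 1%:M) 0
             0 (1%:M *t T_P R nx + T_D R ny *t 1%:M)).

Lemma A_dir_sym : A_dir^T = A_dir.
Proof.
by rewrite tr_block_mx !trmx0 !linearD /= !trmx_tens !trmx1 !(trmx_T_D, trmx_T_E).
Qed.

Lemma A_per_sym : A_per^T = A_per.
Proof.
rewrite tr_block_mx !trmx0 !linearD /= !trmx_tens !trmx1.
by rewrite !(trmx_T_D, trmx_T_E, trmx_T_P).
Qed.

Lemma A_dir_unit : A_dir \in unitmx.
Proof.
have [kx [Kx [<- _]]] := T_E_gram R nx; have [ky [Ky [<- _]]] := T_E_gram R ny.
rewrite block_diag_mx_unit; apply/andP; split; apply: kron_sum_unit.
  by right; apply: B_D_left_inverse.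
by left; apply: B_D_left_inverse.
Qed.

Lemma A_per_unit : A_per \in unitmx.
Proof.
have [ky [Ky [<- Ky_inv]]] := T_E_gram R ny.
rewrite /T_P -[X in X *m _^T]trmxK.
(* [T_P] annihilates constants, so invertibility has to come from the [y] factor in both blocks. *)
rewrite block_diag_mx_unit; apply/andP; split; apply: kron_sum_unit; left=> //.
exact: B_D_left_inverse.
Qed.

(* C is the discrete curl: up to the factor h^2, the identity behind the proof is
   -L = - grad div + curl^T curl + 2 E^T E, the last term coming from the walls. *)
Lemma A_dir_ge_grad_div : psd (A_dir - G_dir^T *m G_dir).
Proof.
pose C := row_mx ((B_D R ny)^T *t 1%:M) (- (1%:M *t (B_D R nx)^T)).
pose E := block_mx (E_0 R ny *t (1%:M : 'M_nx.-1)) 0 0 ((1%:M : 'M_ny.-1) *t E_0 R nx).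
suff -> : A_dir - G_dir^T *m G_dir = C^T *m C + 2%:R *: (E^T *m E).
  by apply: psdD; [|apply: psdZ => //]; apply: psd_gram.
rewrite /C /E !tr_row_mx tr_block_mx mulmx_block !mul_col_row.
rewrite [(- _)^T]linearN /= !(trmx_tens, trmx1, trmx0, trmxK).
rewrite !(mulmx0, mul0mx, addr0, add0r, mulNmx, mulmxN, opprK) !tensmx_mul.
rewrite !(mul1mx, mulmx1, trmx_E_0, E_0_idem) scale_block_mx opp_block_mx.
rewrite !add_block_mx !scaler0 !addr0 !add0r.
rewrite /T_E /T_D /T_N tensmxDl tensmxDr tensmxZl tensmxZr.
(* The mixed products off the diagonal agree because differences in [x] and in [y] commute; the
   diagonal blocks remain. *)
congr block_mx.
  by rewrite addrAC subrr add0r.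
by rewrite addrK.
Qed.

Lemma G_dir_const : G_dir^T *m const_mx 1 = 0 :> 'cV_(ny * nx.-1 + ny.-1 * nx).
Proof.
have oE : const_mx 1 *t const_mx 1 = const_mx 1 :> 'M[R]_(ny * nx, 1 * 1).
  by apply/matrixP => i j; rewrite !mxE mulr1.
suff : G_dir^T *m (const_mx 1 *t const_mx 1 : 'M[R]_(_, 1 * 1)) = 0 by rewrite oE.
rewrite tr_row_mx mul_col_mx !trmx_tens !tensmx_mul !B_D_const tens0mx tensmx0.
exact: col_mx0.
Qed.

End Operators.

(** The admissible [q] live on the [(ny - 2) * (nx - 2)] cells away from all four walls; the [x]
    component of the gradient alone is injective on them. *)
Lemma dirichlet_not_one nx ny (h : R) k :
  0 < h -> (ny * nx <= (ny - 2) * (nx - 2) + k)%N ->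
  at_most_not_one (schur (negL_dir nx ny h) (Gstar_dir nx ny h)) k.
Proof.
move=> h0 k_ge; rewrite schur_scale ?gt_eqF ?A_dir_unit //.
have [Z ZJ] := gradient_interior_left_inverse R nx.
apply: (@at_most_not_one_schur _ _ _ _ _ _ (interior_mx R ny *t interior_mx R nx)
  (row_mx ((interior_mx R ny)^T *t Z) 0)).
- exact: A_dir_unit.
- exact: A_dir_sym.
- by apply: gradient_laplacian_commute; rewrite ?mulmxA // T_E_interior.
- rewrite tr_row_mx mul_col_mx mul_row_col mul0mx addr0 !trmx_tens trmx1.
  by rewrite !tensmx_mul mul1mx ZJ interior_gram tensmx11.
- by rewrite -!subn2.
Qed.

(** Only the two walls in [y] remove cells, so the [x] factor of the admissible space is the
    identity. Injectivity comes from the [y] component, since [B_P^T] annihilates constants. *)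
Lemma periodic_not_one nx ny (h : R) k :
  0 < h -> (ny * nx <= (ny - 2) * nx + k)%N ->
  at_most_not_one (schur (negL_per nx ny h) (Gstar_per nx ny h)) k.
Proof.
move=> h0 k_ge; rewrite schur_scale ?gt_eqF ?A_per_unit //.
have [Z ZJ] := gradient_interior_left_inverse R ny.
apply: (@at_most_not_one_schur _ _ _ _ _ _ (interior_mx R ny *t 1%:M)
  (row_mx 0 (Z *t 1%:M))).
- exact: A_per_unit.
- exact: A_per_sym.
- apply: gradient_laplacian_commute; rewrite ?mulmxA ?T_E_interior //.
  by rewrite /T_P -B_P_normal.
- rewrite tr_row_mx mul_col_mx mul_row_col mul0mx add0r !trmx_tens trmx1.
  by rewrite !tensmx_mul mul1mx ZJ mul1mx tensmx11.
- by rewrite -!subn2.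
Qed.

End TwoDimensional.

Theorem theorem3p4 (R : realType) :
  (forall beta : R, 0 < beta ->
   forall (nx ny : nat) (h : R), (2 <= nx)%N -> (2 <= ny)%N -> 0 < h ->
   inf_sup h (negL_dir nx ny h) (Gstar_dir nx ny h) beta ->
   let S := schur (negL_dir nx ny h) (Gstar_dir nx ny h) in
   exists s : seq R,
     [/\ spectrum S s,
         forall lambda : R, eigenvalue S lambda ->
           lambda = 0 \/ beta ^+ 2 <= lambda <= 1
       & count_mem 0 s = 1%N]) /\
  [/\ forall (n : nat) (h : R), (2 <= n)%N -> 0 < h ->
        at_most_not_one (schur (negL_dir n n h) (Gstar_dir n n h))
                        (4 * (n - 1))%N,
      forall (nx ny : nat) (h : R), (2 <= nx)%N -> (2 <= ny)%N -> 0 < h ->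
        nx <> ny ->
        at_most_not_one (schur (negL_dir nx ny h) (Gstar_dir nx ny h))
                        (2 * (nx - 1) + 2 * (ny - 1))%N
    & forall (nx ny : nat) (h : R), (2 <= nx)%N -> (2 <= ny)%N -> 0 < h ->
        at_most_not_one (schur (negL_per nx ny h) (Gstar_per nx ny h))
                        (2 * nx)%N].
Proof.
split=> [beta b0 nx ny h nx2 ny2 h0 is_h S|].
  have uA : negL_dir nx ny h \in unitmx.
    by rewrite unitmxZ ?A_dir_unit // unitfE invr_eq0 expf_neq0 // gt_eqF.
  apply: (@schur_spectrum_inf_sup _ _ _ _ _ uA _ h beta) => //.
  - by rewrite linearZ /= A_dir_sym.
  - by rewrite muln_gt0; lia.
  - rewrite /Gstar_dir [(_ *: _)^T]linearZ -scalemxAl -scalemxAr scalerA -expr2 exprVn.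
    rewrite /negL_dir -scalerBr; apply: psdZ; last exact: A_dir_ge_grad_div.
    by rewrite invr_ge0 exprn_ge0 ?ltW.
  - by rewrite [(_ *: _)^T]linearZ -scalemxAl G_dir_const scaler0.
split=> [n h n2 h0|nx ny h nx2 ny2 h0 _|nx ny h nx2 ny2 h0].
(* The wall cells number [n^2 - (n - 2)^2 = 4 (n - 1)]; the next two counts are
   [2 (nx - 1) + 2 (ny - 1)] and [2 nx]. *)
- apply: dirichlet_not_one => //.
  by case: n n2 => [|[|n]] // _; rewrite ?subSS ?subn0; nia.
- apply: dirichlet_not_one => //; case: nx nx2 => [|[|nx]] // _.
  by case: ny ny2 => [|[|ny]] // _; rewrite !subSS !subn0; nia.
- apply: periodic_not_one => //.
  by case: ny ny2 => [|[|ny]] // _; rewrite !subSS !subn0; nia.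
Qed.
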